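(* Let $A_a(q)=1-\frac{q^2}{2}+\frac{g_2(a)}{2}q^4$ with $g_2(a)=\frac{a(1-2a)}{2}$, and let $\theta_a(q)$ be the numerical phase defined near $q=0$ by $\cos\theta_a(q)=A_a(q)$, $\theta_a(q)\sim q$ as $q\to0$. No real coefficient $a$ can cancel the leading temporal phase defect, i.e. for no $a\in\mathbb{R}$ does the $q^3$ coefficient $\frac1{24}-\frac{g_2(a)}{2}$ of $\theta_a(q)-q$ vanish. Over $a\in\mathbb{C}$, the cancellation condition $g_2(a)=\frac1{12}$ has exactly the two conjugate solutions $$a_\pm=\frac14\pm\frac{\mathrm{i}}{4\sqrt3},\qquad 1-2a_\pm=\frac12\mp\frac{\mathrm{i}}{2\sqrt3}.$$ For either choice, $$\theta_{a_\pm}(q)=q-\frac{q^5}{720}+\mathcal{O}(q^7)\qquad(q\to0).$$ Consequently, for fixed $\nu>0$ and a fixed semidiscrete wave number $K_h>0$, with $q=\nu\,\Delta t\,K_h$, the temporal frequency error satisfies, as $\Delta t\to0$, $$\frac{\theta_{a_\pm}(q)}{\Delta t}-\nu K_h=-\frac{(\nu K_h)^5}{720}\,\Delta t^4+\mathcal{O}(\Delta t^6).$$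
   Context: Setting. For a nonzero transverse Fourier mode with semidiscrete wave number $K_h$, the energy-scaled semidiscrete lossless Maxwell system with constant wave speed $\nu>0$ reduces to $\frac{d}{dt}(h,e)^{T}=\nu K_h\begin{bmatrix}0&-1\\1&0\end{bmatrix}(h,e)^{T}$, which over a time step $\Delta t$ is a rotation by the phase $q=\nu\Delta tK_h$. Splitting into $C=\nu K_h\begin{bmatrix}0&0\\1&0\end{bmatrix}$ and $D=\nu K_h\begin{bmatrix}0&-1\\0&0\end{bmatrix}$, the five-subflow palindromic composition with parameter $a\in\mathbb{C}$ has the one-step matrix $$M_a(q)=e^{a\Delta t C}e^{\frac12\Delta t D}e^{(1-2a)\Delta t C}e^{\frac12\Delta t D}e^{a\Delta t C},$$ which has determinant $1$ and both diagonal entries equal to $A_a(q)=1-\frac{q^2}{2}+\frac{g_2(a)}{2}q^4$, where $g_2(a)=a(1-2a)/2$. The numerical phase $\theta_a$ is the (analytic near $q=0$) branch with $\cos\theta_a(q)=A_a(q)$ and $\theta_a(q)\sim q$ as $q\to 0$. It has the expansion $\theta_a(q)=q+\left(\frac1{24}-\frac{g_2(a)}2\right)q^3+\mathcal{O}(q^5)$; the $q^3$ term is called the leading temporal phase defect, and it vanishes precisely when $g_2(a)=\frac1{12}$. *)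

(* Defs.v *)
From Stdlib Require Export Reals.
From Coquelicot Require Export Coquelicot.

Open Scope C_scope.

(* [f = O(g)] along [F], in the style of Coquelicot's [is_domin]. *)
Definition is_bigO {T : Type} (F : (T -> Prop) -> Prop) (f g : T -> C) : Prop :=
  exists M : R, F (fun x => (Cmod (f x) <= M * Cmod (g x))%R).

(* Coquelicot has no complex exponential:
   exp (x + i y) = exp x (cos y + i sin y), cos z = (exp (i z) + exp (- i z)) / 2. *)
Definition Cexp (z : C) : C :=
  ((exp (Re z) * cos (Im z))%R, (exp (Re z) * sin (Im z))%R).

Definition Ccos (z : C) : C := (Cexp (Ci * z) + Cexp (- (Ci * z))) / 2.

Definition g2 (a : C) : C := a * (1 - 2 * a) / 2.

Definition A (a q : C) : C := 1 - q ^ 2 / 2 + g2 a / 2 * q ^ 4.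

(* [a] may be complex, hence so may the values of the phase.  Analyticity near 0 is
   complex differentiability on a neighbourhood of 0.  The condition [theta q ~ q]
   selects one branch of [arccos (A a q)], so the germ of [theta] at 0 is determined
   by [a]; the values of [theta] away from 0 are unconstrained. *)
Definition is_numerical_phase (a : C) (theta : C -> C) : Prop :=
  locally (RtoC 0) (fun q : C => ex_derive theta q) /\
  locally (RtoC 0) (fun q : C => Ccos (theta q) = A a q) /\
  is_equiv (locally' (RtoC 0)) theta (fun q : C => q).

(* The coefficient of [q ^ 3] in [theta_a q - q]. *)
Definition leading_phase_defect (a : C) : C := 1 / 24 - g2 a / 2.

Definition a_plus : C := 1 / 4 + Ci / (4 * sqrt 3).
Definition a_minus : C := 1 / 4 - Ci / (4 * sqrt 3).

(* Main.v *)
(* A Taylor polynomial [p] of the phase is certified on the cosines: the Taylor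
   expansion of [cos] shows that [cos p] and [A_a = cos theta_a] agree up to
   [O(q^(n+1))], and since both phases are equivalent to [q], the factorization of
   [cos theta_a - cos p] turns this into [theta_a - p = O(q^n)], without computing any
   derivative of [theta_a].  The phase itself is obtained from a complex logarithm.
   The defect of a real [a] is [(a - 1/4)^2 / 2 + 1/96 > 0]. *)

From Stdlib Require Import Factorial Lra.
Require Import Defs.

(** * Taylor remainders of the complex exponential *)

(** Passing from cosines to phases costs one power of [q]: the cosine is stationary at 0, and the
    factor [theta_a + p], of size about [2 q], has to be divided out. A phase error [O(q ^ 7)] thus
    requires the cosines to agree up to [O(q ^ 8)]. The same degeneracy rules out composing with an
    arccosine for existence, because [A a 0 = 1] is a branch point. It disappears once [1 - A a q]
    is read as [2 (q / 2) ^ 2 (1 - g2 a q ^ 2)]: the double zero is an explicit square, and only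
    square roots and logarithms near 1 remain. The complex analysis rests on a single estimate, the
    bound on the Taylor remainder of the exponential. It yields the lower bound on the sine, the
    expansion of the cosine and the derivatives of exponential and logarithm. *)

Lemma Cexp_plus (z w : C) : Cexp (z + w) = Cexp z * Cexp w.
Proof.
destruct z as [x y], w as [u v]; unfold Cexp; simpl.
rewrite exp_plus, cos_plus, sin_plus.
apply injective_projections; simpl; ring.
Qed.

Lemma Cexp_0 : Cexp 0 = 1.
Proof.
unfold Cexp; simpl; rewrite exp_0, cos_0, sin_0.
apply injective_projections; simpl; ring.
Qed.

Lemma Cexp_opp_r (z : C) : Cexp z * Cexp (- z) = 1.
Proof. rewrite <- Cexp_plus, <- Cexp_0; f_equal; ring. Qed.

Lemma Cexp_neq_0 (z : C) : Cexp z <> 0.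
Proof.
intros H; apply C1_nz; rewrite <- (Cexp_opp_r z), H; ring.
Qed.

Lemma Cmod_Cexp (z : C) : Cmod (Cexp z) = exp (Re z).
Proof.
unfold Cmod, Cexp; simpl.
replace (_ + _)%R with (Rsqr (exp (Re z))).
- apply sqrt_Rsqr, Rlt_le, exp_pos.
- generalize (sin2_cos2 (Im z)); unfold Rsqr; intros H.
  transitivity (exp (Re z) * exp (Re z)
    * (sin (Im z) * sin (Im z) + cos (Im z) * cos (Im z)))%R; [rewrite H|]; ring.
Qed.

Lemma Cmod_le_Re_Im (z : C) (r : R) :
  (Rabs (Re z) <= r)%R -> (Rabs (Im z) <= r)%R -> (Cmod z <= 2 * r)%R.
Proof.
intros Hx Hy.
apply Rle_trans with (1 := Cmod_2Rmax z).
apply Rmult_le_compat.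
- apply sqrt_pos.
- apply Rle_trans with (2 := Rmax_l _ _), Rabs_pos.
- apply Rsqr_incr_0_var; [rewrite Rsqr_sqrt; unfold Rsqr; lra | lra].
- now apply Rmax_lub.
Qed.

Lemma Cmod_Ci : Cmod Ci = 1%R.
Proof. transitivity (sqrt 1); [unfold Cmod, Ci; simpl; f_equal; ring | apply sqrt_1]. Qed.

Lemma im_le_Cmod (z : C) : (Rabs (Im z) <= Cmod z)%R.
Proof.
rewrite <- Rabs_Ropp, <- re_mult_Ci.
apply Rle_trans with (1 := re_le_Cmod _).
rewrite Cmod_mult, Cmod_Ci; lra.
Qed.

(** The index counts the subtracted Taylor terms, so it is also the order to which the remainder
    vanishes at 0. *)
Fixpoint Cexp_rem (n : nat) (z : C) : C :=
  match n with
  | O => Cexp z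
  | S m => Cexp_rem m z - z ^ m / RtoC (INR (fact m))
  end.

Lemma Cexp_rem_S_0 (n : nat) : Cexp_rem (S n) 0 = 0.
Proof.
induction n as [|n IH].
- simpl; rewrite Cexp_0; field; apply C1_nz.
- change (Cexp_rem (S n) 0 - 0 ^ S n / RtoC (INR (fact (S n))) = 0).
  rewrite IH, Cpow_S; unfold Cdiv; ring.
Qed.

(* Componentwise, because the mean value theorem is about real-valued functions. *)
Lemma is_derive_Cexp_rem (n : nat) (z : C) (t : R) :
  is_derive (fun s : R => Re (Cexp_rem (S n) (RtoC s * z))) t
    (Re (z * Cexp_rem n (RtoC t * z))) /\
  is_derive (fun s : R => Im (Cexp_rem (S n) (RtoC s * z))) t
    (Im (z * Cexp_rem n (RtoC t * z))).
Proof.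
induction n as [|n [IHr IHi]].
- destruct z as [x y].
  split.
  + apply is_derive_ext with (fun s => exp (s * x) * cos (s * y) - 1)%R.
    * intros s; simpl; rewrite !Rmult_0_l, Rminus_0_r, Rplus_0_r; field.
    * simpl; auto_derive; auto; rewrite !Rmult_0_l, Rminus_0_r, Rplus_0_r; ring.
  + apply is_derive_ext with (fun s => exp (s * x) * sin (s * y))%R.
    * intros s; simpl; rewrite !Rmult_0_l, Rminus_0_r, Rplus_0_r; field.
    * simpl; auto_derive; auto; rewrite !Rmult_0_l, Rminus_0_r, Rplus_0_r; ring.
- assert (Hf : RtoC (INR (fact n)) <> 0).
  { intros H; apply (INR_fact_neq_0 n), RtoC_inj, H. }
  assert (HS : RtoC (INR (S n)) <> 0).
  { intros H; apply (not_0_INR (S n) (Nat.neq_succ_0 n)), RtoC_inj, H. }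
  assert (E : forall s : R, Cexp_rem (S (S n)) (RtoC s * z)
    = Cexp_rem (S n) (RtoC s * z)
      - RtoC (s ^ S n) * (z ^ S n / RtoC (INR (fact (S n))))).
  { intros s; rewrite RtoC_pow.
    change (Cexp_rem (S n) (RtoC s * z)
      - (RtoC s * z) ^ S n / RtoC (INR (fact (S n)))
      = Cexp_rem (S n) (RtoC s * z)
      - RtoC s ^ S n * (z ^ S n / RtoC (INR (fact (S n))))).
    rewrite Cpow_mult_l; unfold Cdiv; ring. }
  (* Along the segment, the derivative of the Taylor term of degree [S n] is [z] times the term of
     degree [n], so removing one more term is compatible with differentiation. *)
  assert (D : z * Cexp_rem (S n) (RtoC t * z) = z * Cexp_rem n (RtoC t * z)
    - RtoC (INR (S n) * t ^ n) * (z ^ S n / RtoC (INR (fact (S n))))).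
  { change (Cexp_rem (S n) (RtoC t * z)) with
      (Cexp_rem n (RtoC t * z) - (RtoC t * z) ^ n / RtoC (INR (fact n))).
    rewrite fact_simpl, mult_INR, !RtoC_mult, Cpow_mult_l, RtoC_pow, Cpow_S.
    field; auto. }
  rewrite D.
  split.
  + apply is_derive_ext with (fun s => Re (Cexp_rem (S n) (RtoC s * z))
      - s ^ S n * Re (z ^ S n / RtoC (INR (fact (S n)))))%R.
    { intros s; rewrite E; unfold Cminus.
      now rewrite re_plus, re_opp, re_scal_l. }
    unfold Cminus; rewrite re_plus, re_opp, re_scal_l.
    generalize (Re (z ^ S n / RtoC (INR (fact (S n))))) as k; intros k.
    apply @is_derive_minus; [exact IHr|].
    auto_derive; auto.
    change (pred (S n)) with n.
    change (match n with O => 1%R | S _ => (INR n + 1)%R end) with (INR (S n)).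
    ring.
  + apply is_derive_ext with (fun s => Im (Cexp_rem (S n) (RtoC s * z))
      - s ^ S n * Im (z ^ S n / RtoC (INR (fact (S n)))))%R.
    { intros s; rewrite E; unfold Cminus.
      now rewrite im_plus, im_opp, im_scal_l. }
    unfold Cminus; rewrite im_plus, im_opp, im_scal_l.
    generalize (Im (z ^ S n / RtoC (INR (fact (S n))))) as k; intros k.
    apply @is_derive_minus; [exact IHi|].
    auto_derive; auto.
    change (pred (S n)) with n.
    change (match n with O => 1%R | S _ => (INR n + 1)%R end) with (INR (S n)).
    ring.
Qed.

Lemma Rabs_le_of_derive_bound (f df : R -> R) (t M : R) :
  (0 <= t <= 1)%R -> f 0%R = 0%R ->
  (forall s, is_derive f s (df s)) ->
  (forall s, (0 <= s <= 1)%R -> (Rabs (df s) <= M)%R) ->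
  (Rabs (f t) <= M)%R.
Proof.
intros Ht H0 Hd HM.
destruct (MVT_gen f 0 t df) as [c [Hc E]].
- intros; apply Hd.
- intros x _; apply continuity_pt_filterlim, (@ex_derive_continuous R_AbsRing R_NormedModule).
  now exists (df x).
- rewrite Rmin_left, Rmax_right in Hc by lra.
  rewrite H0, !Rminus_0_r in E; rewrite E, Rabs_mult, (Rabs_pos_eq t) by lra.
  assert (Hs : (0 <= c <= 1)%R) by lra.
  specialize (HM c Hs); pose proof (Rabs_pos (df c)); nra.
Qed.

(** Since differentiating a remainder along the segment gives [z] times the preceding one, the mean
    value theorem raises the order by one. The induction needs the bound on the whole segment, hence
    the parameter [t]. Treating real and imaginary parts separately costs a factor 2 at each
    step. *)
Lemma Cexp_rem_bound_segment (n : nat) (z : C) (t : R) : (0 <= t <= 1)%R ->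
  (Cmod (Cexp_rem n (RtoC t * z)) <= (2 * Cmod z) ^ n * exp (Cmod z))%R.
Proof.
intros Ht; revert t Ht; induction n as [|n IH]; intros t Ht.
- change (Cexp_rem 0 (RtoC t * z)) with (Cexp (RtoC t * z)).
  rewrite Cmod_Cexp, re_scal_l, Rmult_1_l.
  assert (H : (t * Re z <= Cmod z)%R).
  { pose proof (re_le_Cmod z); pose proof (Rle_abs (Re z)).
    pose proof (Rabs_pos (Re z)); nra. }
  destruct H as [H|H]; [left; now apply exp_increasing | right; now rewrite H].
- replace ((2 * Cmod z) ^ S n * exp (Cmod z))%R
    with (2 * (Cmod z * ((2 * Cmod z) ^ n * exp (Cmod z))))%R by (simpl; ring).
  assert (HM : forall s, (0 <= s <= 1)%R -> (Cmod (z * Cexp_rem n (RtoC s * z))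
    <= Cmod z * ((2 * Cmod z) ^ n * exp (Cmod z)))%R).
  { intros s Hs; rewrite Cmod_mult.
    apply Rmult_le_compat_l; [apply Cmod_ge_0 | now apply IH]. }
  apply Cmod_le_Re_Im.
  + apply (Rabs_le_of_derive_bound (fun s => Re (Cexp_rem (S n) (RtoC s * z)))
      (fun s => Re (z * Cexp_rem n (RtoC s * z)))); auto.
    * now rewrite Cmult_0_l, Cexp_rem_S_0.
    * intros s; apply is_derive_Cexp_rem.
    * intros s Hs; apply Rle_trans with (1 := re_le_Cmod _); auto.
  + apply (Rabs_le_of_derive_bound (fun s => Im (Cexp_rem (S n) (RtoC s * z)))
      (fun s => Im (z * Cexp_rem n (RtoC s * z)))); auto.
    * now rewrite Cmult_0_l, Cexp_rem_S_0.
    * intros s; apply is_derive_Cexp_rem.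
    * intros s Hs; apply Rle_trans with (1 := im_le_Cmod _); auto.
Qed.

Lemma Cexp_rem_bound (n : nat) (z : C) : (Cmod z <= 1)%R ->
  (Cmod (Cexp_rem n z) <= 3 * 2 ^ n * Cmod z ^ n)%R.
Proof.
intros Hz.
replace z with (RtoC 1 * z) at 1 by ring.
apply Rle_trans with (1 := Cexp_rem_bound_segment n z 1 ltac:(lra)).
rewrite Rpow_mult_distr.
assert (He : (exp (Cmod z) <= 3)%R).
{ apply Rle_trans with (2 := exp_le_3).
  destruct Hz as [H|H]; [left; now apply exp_increasing | right; now rewrite H]. }
assert (H2 : (0 <= 2 ^ n * Cmod z ^ n)%R).
{ apply Rmult_le_pos; apply pow_le; [lra | apply Cmod_ge_0]. }
nra.
Qed.

(** * Complex cosine and sine *)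

Lemma Ci_Ci : Ci * Ci = - 1.
Proof. apply injective_projections; simpl; ring. Qed.

Lemma Ci_pow2 : Ci ^ 2 = - 1.
Proof. rewrite <- Ci_Ci; simpl; ring. Qed.

Lemma RtoC_neq_0 (x : R) : x <> 0%R -> RtoC x <> 0.
Proof. intros H E; apply H, RtoC_inj, E. Qed.

Lemma Cmod_Ci_mult (z : C) : Cmod (Ci * z) = Cmod z.
Proof. rewrite Cmod_mult, Cmod_Ci; apply Rmult_1_l. Qed.

Definition Csin (z : C) : C := (Cexp (Ci * z) - Cexp (- (Ci * z))) / (2 * Ci).

Lemma Ccos_diff (u v : C) :
  Ccos u - Ccos v = - 2 * Csin ((u + v) / 2) * Csin ((u - v) / 2).
Proof.
set (a := Ci * ((u + v) / 2)); set (b := Ci * ((u - v) / 2)).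
assert (H2 : RtoC 2 <> 0) by (apply RtoC_neq_0; lra).
unfold Ccos, Csin; fold a b.
replace (Ci * u) with (a + b) by (unfold a, b; field; auto).
replace (Ci * v) with (a + - b) by (unfold a, b; field; auto).
replace (- (a + b)) with (- a + - b) by ring.
replace (- (a + - b)) with (- a + b) by ring.
rewrite !Cexp_plus.
(* [field] sees [Ci] as an atom, so the product of the two denominators [2 * Ci] is reduced to [- 4]
   by hand. *)
assert (E : forall w x y : C, w * (x / (2 * Ci)) * (y / (2 * Ci)) = - (w * x * y / 4)).
{ intros w x y.
  replace (w * (x / (2 * Ci)) * (y / (2 * Ci))) with (w * x * y / (4 * (Ci * Ci))).
  - rewrite Ci_Ci; field; apply RtoC_neq_0; lra.
  - field; apply Ci_nz. }
rewrite E; field; auto.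
Qed.

Lemma Cmod_half_le (x y : C) (r : R) :
  (Cmod x <= r)%R -> (Cmod y <= r)%R -> (Cmod ((x + y) / 2) <= r)%R.
Proof.
intros Hx Hy.
rewrite Cmod_div by (apply RtoC_neq_0; lra).
rewrite Cmod_R, Rabs_pos_eq by lra.
pose proof (Cmod_triangle x y); lra.
Qed.

(** The second-order remainders give an error [Cmod (Csin z - z)] of at most [12 * Cmod z ^ 2],
    which is below [Cmod z / 2] exactly when [Cmod z <= 1 / 24]. *)
Lemma Csin_lower_bound (z : C) : (Cmod z <= 1 / 24)%R ->
  (Cmod z / 2 <= Cmod (Csin z))%R.
Proof.
intros Hz.
assert (H2 : RtoC 2 <> 0) by (apply RtoC_neq_0; lra).
assert (H1 : RtoC 1 <> 0) by (apply RtoC_neq_0; lra).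
assert (E : Ci * (Csin z - z)
  = (Cexp_rem 2 (Ci * z) + - Cexp_rem 2 (- (Ci * z))) / 2).
{ simpl; unfold Csin; field; repeat split; auto; apply Ci_nz. }
assert (B : (Cmod (Csin z - z) <= 3 * 2 ^ 2 * Cmod z ^ 2)%R).
{ rewrite <- (Cmod_Ci_mult (_ - _)), E.
  rewrite <- (Cmod_Ci_mult z).
  apply Cmod_half_le; [|rewrite Cmod_opp, <- (Cmod_opp (Ci * z))];
    apply Cexp_rem_bound; rewrite ?Cmod_opp, Cmod_Ci_mult; lra. }
pose proof (Cmod_triangle (Csin z) (- (Csin z - z))) as T.
replace (Csin z + - (Csin z - z)) with z in T by ring.
rewrite Cmod_opp in T; pose proof (Cmod_ge_0 z); nra.
Qed.

(** In the product formula each sine is at least half its argument, which is itself a half sum or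
    half difference: [2 * (1 / 4) * (1 / 4) = 1 / 8]. *)
Lemma Ccos_diff_lower_bound (u v : C) :
  (Cmod u <= 1 / 24)%R -> (Cmod v <= 1 / 24)%R ->
  (Cmod (u + v) * Cmod (u - v) <= 8 * Cmod (Ccos u - Ccos v))%R.
Proof.
intros Hu Hv.
rewrite Ccos_diff, !Cmod_mult, Cmod_R, Rabs_left by lra.
assert (H2 : RtoC 2 <> 0) by (apply RtoC_neq_0; lra).
assert (Hp : (Cmod ((u + v) / 2) <= 1 / 24)%R) by (apply Cmod_half_le; lra).
assert (Hm : (Cmod ((u - v) / 2) <= 1 / 24)%R).
{ apply Cmod_half_le; rewrite ?Cmod_opp; lra. }
apply Csin_lower_bound in Hp, Hm.
rewrite Cmod_div, Cmod_R, Rabs_pos_eq in Hp, Hm by (auto; lra).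
pose proof (Cmod_ge_0 (u + v)); pose proof (Cmod_ge_0 (u - v)).
assert (Cmod (u + v) / 2 / 2 * (Cmod (u - v) / 2 / 2)
  <= Cmod (Csin ((u + v) / 2)) * Cmod (Csin ((u - v) / 2)))%R.
{ apply Rmult_le_compat; lra. }
lra.
Qed.

(** Averaging the remainders at [Ci * z] and [- (Ci * z)] cancels the odd terms, so the remainder of
    index 6 already belongs to the polynomial of degree 4, and that of index 8 to degree 6. *)
Lemma Ccos_taylor (z : C) : (Cmod z <= 1)%R ->
  (Cmod (Ccos z - (1 - z ^ 2 / 2 + z ^ 4 / 24)) <= 192 * Cmod z ^ 6)%R /\
  (Cmod (Ccos z - (1 - z ^ 2 / 2 + z ^ 4 / 24 - z ^ 6 / 720))
    <= 768 * Cmod z ^ 8)%R.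
Proof.
intros Hz.
assert (HR : forall n, (Cmod ((Cexp_rem n (Ci * z) + Cexp_rem n (- (Ci * z))) / 2)
  <= 3 * 2 ^ n * Cmod z ^ n)%R).
{ intros n; rewrite <- (Cmod_Ci_mult z).
  apply Cmod_half_le; [|rewrite <- (Cmod_opp (Ci * z))];
    apply Cexp_rem_bound; rewrite ?Cmod_opp, Cmod_Ci_mult; lra. }
replace (z ^ 2) with (- (Ci * z) ^ 2) by (rewrite Cpow_mult_l, Ci_pow2; ring).
replace (z ^ 4) with ((Ci * z) ^ 4)
  by (rewrite Cpow_mult_l, (Cpow_mult_r Ci 2 2 : Ci ^ 4 = _), Ci_pow2; ring).
replace (z ^ 6) with (- (Ci * z) ^ 6)
  by (rewrite Cpow_mult_l, (Cpow_mult_r Ci 2 3 : Ci ^ 6 = _), Ci_pow2; ring).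
replace 192%R with (3 * 2 ^ 6)%R by ring.
replace 768%R with (3 * 2 ^ 8)%R by ring.
split; [apply Rle_trans with (2 := HR 6%nat) | apply Rle_trans with (2 := HR 8%nat)];
  right; f_equal; unfold Ccos; generalize (Ci * z) as w; intros w;
  cbv [Cexp_rem]; rewrite !INR_IZR_INZ; simpl (Z.of_nat _);
  field; repeat split; apply RtoC_neq_0; lra.
Qed.

(** * Expansion of the phase *)

Lemma locally_C_Cmod (z : C) (P : C -> Prop) :
  locally (T := C_UniformSpace) z P <->
  exists d : posreal, forall w : C, (Cmod (w - z) < d)%R -> P w.
Proof. rewrite locally_C; split; intros [d H]; exists d; exact H. Qed.

Local Notation near0 := (locally' (T := C_UniformSpace) (RtoC 0)).

Lemma near0_and (P Q : C -> Prop) : near0 P -> near0 Q ->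
  near0 (fun q => P q /\ Q q).
Proof. apply filter_and. Qed.

Lemma locally'_0_small (r : R) : (0 < r)%R ->
  near0 (fun q => 0 < Cmod q < r)%R.
Proof.
intros Hr; apply locally_C_Cmod; exists (mkposreal r Hr); simpl.
intros q Hq H0; replace (q - 0) with q in Hq by ring.
split; [now apply Cmod_gt_0 | exact Hq].
Qed.

Lemma locally'_0_monomial_le (c : C) (k : nat) :
  near0
    (fun q => Cmod (c * q ^ S (S k)) <= Cmod q / 4)%R.
Proof.
pose proof (Cmod_ge_0 c) as Hc.
(* The [+ 1] covers [c = 0] and forces [Cmod q < 1], so that the surplus factor [q ^ k] has modulus
   at most 1. *)
set (r := (/ (4 * (Cmod c + 1)))%R).
assert (Hr : (0 < r)%R) by (apply Rinv_0_lt_compat; lra).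
assert (Er : (r * (4 * (Cmod c + 1)) = 1)%R) by (apply Rinv_l; lra).
generalize (locally'_0_small r Hr); apply filter_imp; intros q Hq.
rewrite Cmod_mult, Cmod_pow; simpl pow.
assert (Hk : (0 <= Cmod q ^ k <= 1)%R).
{ split; [apply pow_le; lra|].
  rewrite <- (pow1 k); apply pow_incr; nra. }
assert (H : (Cmod c * Cmod q <= 1 / 4)%R) by nra.
assert (H' : (Cmod q * Cmod q ^ k <= Cmod q)%R) by nra.
assert (H'' : (0 <= Cmod q * Cmod q ^ k)%R) by nra.
replace (Cmod c * (Cmod q * (Cmod q * Cmod q ^ k)))%R
  with ((Cmod c * Cmod q) * (Cmod q * Cmod q ^ k))%R by ring.
nra.
Qed.

(** Near 0 both [theta q] and its candidate lie within [Cmod q / 4] of [q], so their sum has modulus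
    at least [Cmod q]. Dividing the cosine error by it leaves a bound on the difference of the
    phases, one order lower. The exponent [S (S k)] makes the correction negligible against [q]. *)
Lemma phase_approx (a c : C) (theta : C -> C) (k n : nat) (M : R) :
  is_numerical_phase a theta ->
  near0 (fun q =>
    Cmod (Ccos (q + c * q ^ S (S k)) - A a q) <= M * Cmod q ^ S n)%R ->
  is_bigO near0
    (fun q => theta q - (q + c * q ^ S (S k))) (fun q => q ^ n).
Proof.
intros [_ [Hcos Heq]] HM.
exists (8 * M)%R.
assert (Hcos' : near0
  (fun q => Ccos (theta q) = A a q)).
{ destruct Hcos as [d Hd]; exists d; intros q Hq _; exact (Hd q Hq). }
specialize (Heq (mkposreal (1 / 4) ltac:(lra))).
(* The radius [1 / 48] keeps both phases, of modulus at most [5 / 4 * Cmod q], inside the disc of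
   radius [1 / 24] where the cosine bound applies. *)
generalize (near0_and _ _ (near0_and _ _ Hcos' Heq) (near0_and _ _ HM
  (near0_and _ _ (locally'_0_small (1 / 48) ltac:(lra)) (locally'_0_monomial_le c k)))).
apply filter_imp; clear; intros q [[Hcos Heq] [HM [Hq Hp]]].
change (Cmod (q - theta q) <= 1 / 4 * Cmod q)%R in Heq.
set (e := c * q ^ S (S k)) in *.
set (u := theta q) in *.
assert (Hu : (Cmod u <= 5 / 4 * Cmod q)%R).
{ pose proof (Cmod_triangle q (- (q - u))) as T; rewrite Cmod_opp in T.
  replace (q + - (q - u)) with u in T by ring; lra. }
assert (Hv : (Cmod (q + e) <= 5 / 4 * Cmod q)%R).
{ pose proof (Cmod_triangle q e); lra. }
assert (Hs : (Cmod q <= Cmod (u + (q + e)))%R).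
{ pose proof (Cmod_triangle (u + (q + e)) ((q - u) + - e)) as T.
  replace (u + (q + e) + (q - u + - e)) with (2 * q) in T by ring.
  pose proof (Cmod_triangle (q - u) (- e)) as T'.
  rewrite Cmod_opp in T'.
  rewrite Cmod_mult, Cmod_R, Rabs_pos_eq in T by lra; lra. }
assert (HD := Ccos_diff_lower_bound u (q + e) ltac:(lra) ltac:(lra)).
rewrite <- Hcos, <- Cmod_opp in HM.
replace (- (Ccos (q + e) - Ccos u)) with (Ccos u - Ccos (q + e)) in HM by ring.
rewrite Cmod_pow; simpl pow in HM.
apply Rmult_le_reg_l with (Cmod q); [lra|].
pose proof (Cmod_ge_0 (u - (q + e))).
apply Rle_trans with (Cmod (u + (q + e)) * Cmod (u - (q + e)))%R; [nra|].
lra.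
Qed.

(** Serves for the polynomial cofactors of [q ^ n] in the error terms: only their boundedness
    matters, and it follows from their syntax without numerical estimates. *)
Definition bounded_on_unit_disc (f : C -> C) : Prop :=
  exists M : R, forall q : C, (Cmod q <= 1)%R -> (Cmod (f q) <= M)%R.

Lemma bounded_const (c : C) : bounded_on_unit_disc (fun _ => c).
Proof. exists (Cmod c); intros; apply Rle_refl. Qed.

Lemma bounded_id : bounded_on_unit_disc (fun q => q).
Proof. exists 1%R; auto. Qed.

Lemma bounded_plus (f g : C -> C) : bounded_on_unit_disc f ->
  bounded_on_unit_disc g -> bounded_on_unit_disc (fun q => f q + g q).
Proof.
intros [M HM] [N HN]; exists (M + N)%R; intros q Hq.
specialize (HM q Hq); specialize (HN q Hq).
pose proof (Cmod_triangle (f q) (g q)); lra.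
Qed.

Lemma bounded_mult (f g : C -> C) : bounded_on_unit_disc f ->
  bounded_on_unit_disc g -> bounded_on_unit_disc (fun q => f q * g q).
Proof.
intros [M HM] [N HN]; exists (M * N)%R; intros q Hq.
rewrite Cmod_mult; apply Rmult_le_compat; auto using Cmod_ge_0.
Qed.

Lemma bounded_pow (f : C -> C) (n : nat) : bounded_on_unit_disc f ->
  bounded_on_unit_disc (fun q => f q ^ n).
Proof.
intros Hf; induction n as [|n IH]; [exact (bounded_const 1)|].
now apply (bounded_mult f (fun q => f q ^ n)).
Qed.

Ltac bounded_polynomial :=
  repeat first [apply bounded_const | apply bounded_id | apply bounded_pow
    | apply bounded_plus | apply bounded_mult].

(** [T] is meant to be a Taylor polynomial of the cosine evaluated at [p q]. The analytic error
    [Ccos (p q) - T q] is controlled through [Cmod (p q) <= 2 * Cmod q], whence the factor [2 ^ n];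
    the algebraic error [T - A a] is divisible by [q ^ n], which is where the coefficients of [p]
    enter. *)
Lemma cos_error_bound (T p : C -> C) (a : C) (f : C -> C) (K : R) (n : nat) :
  bounded_on_unit_disc f ->
  (forall q, T q - A a q = q ^ n * f q) ->
  near0 (fun q => Cmod (p q - q) <= Cmod q / 4)%R ->
  (forall q, (Cmod (p q) <= 1)%R -> (Cmod (Ccos (p q) - T q) <= K * Cmod (p q) ^ n)%R) ->
  (0 <= K)%R ->
  exists M : R, near0
    (fun q => Cmod (Ccos (p q) - A a q) <= M * Cmod q ^ n)%R.
Proof.
intros [M HM] HT Hp HK K0; exists (K * 2 ^ n + M)%R.
generalize (near0_and _ _ Hp (locally'_0_small (1 / 2) ltac:(lra))).
apply filter_imp; clear Hp; intros q [Hp Hq].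
assert (H2 : (Cmod (p q) <= 2 * Cmod q)%R).
{ pose proof (Cmod_triangle (p q - q) q) as H.
  replace (p q - q + q) with (p q) in H by ring; lra. }
assert (H3 : (Cmod (p q) ^ n <= 2 ^ n * Cmod q ^ n)%R).
{ rewrite <- Rpow_mult_distr; apply pow_incr; split; [apply Cmod_ge_0 | exact H2]. }
specialize (HK q ltac:(lra)); specialize (HM q ltac:(lra)).
pose proof (Cmod_triangle (Ccos (p q) - T q) (T q - A a q)) as H.
replace (Ccos (p q) - T q + (T q - A a q)) with (Ccos (p q) - A a q) in H by ring.
rewrite HT, Cmod_mult, Cmod_pow in H.
assert (Hn : (0 <= Cmod q ^ n)%R) by (apply pow_le; lra).
nra.
Qed.

Lemma phase_expansion3 (a : C) (theta : C -> C) : is_numerical_phase a theta ->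
  is_bigO near0
    (fun q : C => theta q - (q + leading_phase_defect a * q ^ 3))
    (fun q : C => q ^ 5).
Proof.
intros Hth.
set (c := leading_phase_defect a).
set (p := fun q => q + c * q ^ 3).
(* The [q ^ 4] coefficient of the algebraic error is [- c + 1 / 24 - g2 a / 2], zero by the choice
   of [c]; the function supplied is the quotient of what remains by [q ^ 6]. *)
destruct (cos_error_bound (fun q => 1 - p q ^ 2 / 2 + p q ^ 4 / 24) p a
  (fun q => - c ^ 2 / 2
    + / 24 * (4 * c + 6 * c ^ 2 * q ^ 2 + 4 * c ^ 3 * q ^ 4 + c ^ 4 * q ^ 6)) 192 6)
  as [M HM].
- bounded_polynomial.
- intros q; unfold p, A.
  replace (g2 a) with (1 / 12 - 2 * c) by
    (unfold c, leading_phase_defect; field; repeat split; apply RtoC_neq_0; lra).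
  field; repeat split; apply RtoC_neq_0; lra.
- generalize (locally'_0_monomial_le c 1); apply filter_imp; intros q Hq.
  unfold p; replace (q + c * q ^ 3 - q) with (c * q ^ 3) by ring; exact Hq.
- intros q Hq; now apply Ccos_taylor.
- lra.
- exact (phase_approx a c theta 1 5 M Hth HM).
Qed.

Lemma phase_expansion5 (a : C) (theta : C -> C) : is_numerical_phase a theta ->
  g2 a = 1 / 12 ->
  is_bigO near0
    (fun q : C => theta q - (q - q ^ 5 / 720))
    (fun q : C => q ^ 7).
Proof.
intros Hth Ha.
(* When [g2 a = 1 / 12], [A a] is the Taylor polynomial of the cosine of degree 4. Adding
   [c * q ^ 5] to the phase contributes [- c * q ^ 6] to the cosine, and this must offset its own
   term [- q ^ 6 / 720]. *)
set (c := - / 720 : C).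
set (p := fun q => q + c * q ^ 5).
destruct (cos_error_bound
  (fun q => 1 - p q ^ 2 / 2 + p q ^ 4 / 24 - p q ^ 6 / 720) p a
  (fun q => - / 2 * c ^ 2 * q ^ 2
    + c / 24 * (4 + 6 * (c * q ^ 4) + 4 * (c * q ^ 4) ^ 2 + (c * q ^ 4) ^ 3)
    + - c / 720 * q ^ 2 * (6 + 15 * (c * q ^ 4) + 20 * (c * q ^ 4) ^ 2
        + 15 * (c * q ^ 4) ^ 3 + 6 * (c * q ^ 4) ^ 4 + (c * q ^ 4) ^ 5)) 768 8)
  as [M HM].
- bounded_polynomial.
- intros q; unfold p, A; rewrite Ha; unfold c.
  field; repeat split; apply RtoC_neq_0; lra.
- generalize (locally'_0_monomial_le c 3); apply filter_imp; intros q Hq.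
  unfold p; replace (q + c * q ^ 5 - q) with (c * q ^ 5) by ring; exact Hq.
- intros q Hq; now apply Ccos_taylor.
- lra.
- destruct (phase_approx a c theta 3 7 M Hth HM) as [N HN]; exists N.
  revert HN; apply filter_imp; intros q Hq.
  replace (q - q ^ 5 / 720) with (q + c * q ^ 5); [exact Hq|].
  unfold c; field; apply RtoC_neq_0; lra.
Qed.

(** With [w = nu * Kh], substituting [q = w * dt] and dividing by [dt] turns [M * Cmod q ^ 7] into
    [M * w ^ 7] times the sixth power of the modulus of [dt]. *)
Lemma frequency_error (theta : C -> C) (nu Kh : R) : (0 < nu)%R -> (0 < Kh)%R ->
  is_bigO near0
    (fun q : C => theta q - (q - q ^ 5 / 720)) (fun q : C => q ^ 7) ->
  is_bigO (locally' (0%R : R))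
    (fun dt : R =>
       theta (RtoC (nu * dt * Kh)%R) / RtoC dt - RtoC (nu * Kh)%R
       - - (RtoC (nu * Kh)%R ^ 5 / 720) * RtoC dt ^ 4)
    (fun dt : R => RtoC dt ^ 6).
Proof.
intros Hnu HK [M HM]; set (w := (nu * Kh)%R).
assert (Hw : (0 < w)%R) by now apply Rmult_lt_0_compat.
exists (M * w ^ 7)%R.
apply locally_C_Cmod in HM; destruct HM as [d Hd].
exists (mkposreal (d / w) (Rdiv_lt_0_compat _ _ (cond_pos d) Hw)).
intros t Ht H0.
replace (nu * t * Kh)%R with (w * t)%R by (unfold w; ring).
change (Rabs (t - 0) < d / w)%R in Ht; rewrite Rminus_0_r in Ht.
assert (Htp : (0 < Rabs t)%R) by now apply Rabs_pos_lt.
assert (Hwt : Cmod (RtoC (w * t)) = (w * Rabs t)%R).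
{ rewrite Cmod_R, Rabs_mult, (Rabs_pos_eq w); lra. }
specialize (Hd (RtoC (w * t))); simpl in Hd.
assert (Hlt : (Cmod (RtoC (w * t) - 0) < d)%R).
{ replace (RtoC (w * t) - 0) with (RtoC (w * t)) by ring; rewrite Hwt.
  apply Rmult_lt_reg_l with (/ w)%R; [now apply Rinv_0_lt_compat|].
  replace (/ w * (w * Rabs t))%R with (Rabs t) by (field; lra).
  replace (/ w * d)%R with (d / w)%R by (field; lra); exact Ht. }
assert (Hn0 : RtoC (w * t) <> 0) by
  (apply RtoC_neq_0, Rmult_integral_contrapositive_currified; lra).
specialize (Hd Hlt Hn0).
assert (Ht0 : RtoC t <> 0) by now apply RtoC_neq_0.
change (Cmod (theta (RtoC (w * t)) - (RtoC (w * t) - RtoC (w * t) ^ 5 / 720))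
  <= M * Cmod (RtoC (w * t) ^ 7))%R in Hd.
replace (theta (RtoC (w * t)) / RtoC t - RtoC w - - (RtoC w ^ 5 / 720) * RtoC t ^ 4)
  with ((theta (RtoC (w * t)) - (RtoC (w * t) - RtoC (w * t) ^ 5 / 720)) / RtoC t).
2: { rewrite (RtoC_mult w t); field; auto. }
rewrite Cmod_div by auto.
rewrite Cmod_pow, Hwt in Hd; rewrite Cmod_pow, Cmod_R.
apply Rmult_le_reg_l with (Rabs t); [auto|].
unfold Rdiv; rewrite <- Rmult_assoc, (Rmult_comm (Rabs t)), Rmult_assoc, Rinv_r by lra.
rewrite Rmult_1_r; apply Rle_trans with (1 := Hd); right; ring.
Qed.

(** * Complex logarithm *)

(* The complex plane as a normed module over itself, where the product and chain
   rules apply; [C_NormedModule] carries the same norm but another uniform structure. *)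
Definition is_C_derive (f : C -> C) (z l : C) : Prop :=
  is_derive (K := C_AbsRing) (V := AbsRing_NormedModule C_AbsRing) f z l.

Lemma is_C_derive_correct (f : C -> C) (z l : C) :
  is_C_derive f z l -> is_derive (K := C_AbsRing) (V := C_NormedModule) f z l.
Proof.
intros [[H1 H2 H3] H]; split; [split|]; [exact H1 | exact H2 | exact H3 | exact H].
Qed.

Lemma is_C_derive_eps (f : C -> C) (z l : C) :
  is_C_derive f z l <->
  forall eps : posreal, exists d : posreal, forall w : C, (Cmod (w - z) < d)%R ->
    (Cmod (f w - f z - (w - z) * l) <= eps * Cmod (w - z))%R.
Proof.
split.
- intros [_ H] eps.
  exact (H z (fun P HP => HP) eps).
- intros H; split.
  + apply (is_linear_scal_l (K := C_AbsRing) (V := AbsRing_NormedModule C_AbsRing)).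
  + intros x Hx eps.
    (* Differentiability asks for the estimate at every limit [x] of the neighbourhood filter of
       [z]; uniqueness of limits leaves only [z]. *)
    assert (E : z = x).
    { apply (is_filter_lim_locally_unique (K := C_AbsRing)
        (V := AbsRing_NormedModule C_AbsRing)); exact Hx. }
    rewrite <- E; exact (H eps).
Qed.

Lemma is_C_derive_const (c z : C) : is_C_derive (fun _ => c) z 0.
Proof. apply @is_derive_const. Qed.

Lemma is_C_derive_id (z : C) : is_C_derive (fun w => w) z 1.
Proof. apply @is_derive_id. Qed.

Lemma is_C_derive_plus (f g : C -> C) (z l m : C) : is_C_derive f z l ->
  is_C_derive g z m -> is_C_derive (fun w => f w + g w) z (l + m).
Proof. apply @is_derive_plus. Qed.

Lemma is_C_derive_mult (f g : C -> C) (z l m : C) : is_C_derive f z l ->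
  is_C_derive g z m -> is_C_derive (fun w => f w * g w) z (l * g z + f z * m).
Proof. intros Hf Hg; apply (is_derive_mult (K := C_AbsRing)); auto using Cmult_comm. Qed.

Lemma is_C_derive_comp (f g : C -> C) (z l m : C) : is_C_derive f (g z) l ->
  is_C_derive g z m -> is_C_derive (fun w => f (g w)) z (m * l).
Proof. apply @is_derive_comp. Qed.

Lemma is_C_derive_Cexp (z : C) : is_C_derive Cexp z (Cexp z).
Proof.
apply is_C_derive_eps; intros eps.
assert (Hz : (0 < Cmod (Cexp z))%R) by apply Cmod_gt_0, Cexp_neq_0.
set (r := (eps / (12 * Cmod (Cexp z)))%R).
assert (Hr : (0 < r)%R) by (apply Rdiv_lt_0_compat; [apply cond_pos | lra]).
assert (Er : (12 * Cmod (Cexp z) * r = eps)%R) by (unfold r; field; lra).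
exists (mkposreal (Rmin 1 r) ltac:(apply Rmin_pos; lra)); simpl; intros w Hw.
assert (H1 := Rlt_le_trans _ _ _ Hw (Rmin_l 1 r)).
assert (H2 := Rlt_le_trans _ _ _ Hw (Rmin_r 1 r)).
set (u := w - z) in *.
replace (Cexp w - Cexp z - u * Cexp z) with (Cexp z * Cexp_rem 2 u).
- rewrite Cmod_mult; pose proof (Cexp_rem_bound 2 u ltac:(lra)) as B.
  pose proof (Cmod_ge_0 u) as Hu.
  apply Rle_trans with (Cmod (Cexp z) * (12 * (Cmod u * r)))%R.
  + apply Rmult_le_compat_l; [lra|]; apply Rle_trans with (1 := B); simpl; nra.
  + right; rewrite <- Er; ring.
- replace w with (z + u) by (unfold u; ring); rewrite Cexp_plus.
  simpl; field; apply C1_nz.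
Qed.

(* Principal branch, meaningful on [Re z > 0] only. *)
Definition Clog (z : C) : C :=
  ((ln (Re z ^ 2 + Im z ^ 2) / 2)%R, atan (Im z / Re z)).

Lemma Cexp_Clog (z : C) : (0 < Re z)%R -> Cexp (Clog z) = z.
Proof.
destruct z as [x y]; intros Hx; change (0 < x)%R in Hx.
change ((exp (ln (x ^ 2 + y ^ 2) / 2) * cos (atan (y / x)),
  exp (ln (x ^ 2 + y ^ 2) / 2) * sin (atan (y / x)))%R = (x, y)).
assert (Hp : (0 < x ^ 2 + y ^ 2)%R) by nra.
assert (He : exp (ln (x ^ 2 + y ^ 2) / 2) = sqrt (x ^ 2 + y ^ 2)).
{ rewrite <- Rpower_sqrt by auto; unfold Rpower; f_equal; field. }
(* Positivity of [x] allows factoring it out, and the remaining root cancels the denominators in the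
   cosine and sine of an arctangent. *)
assert (Hs : sqrt (x ^ 2 + y ^ 2) = (x * sqrt (1 + (y / x)²))%R).
{ rewrite <- (sqrt_Rsqr x) at 2 by lra.
  rewrite <- sqrt_mult_alt by apply Rle_0_sqr.
  f_equal; unfold Rsqr; field; lra. }
assert (H1 : (0 < sqrt (1 + (y / x)²))%R).
{ apply sqrt_lt_R0; pose proof (Rle_0_sqr (y / x)); lra. }
rewrite He, Hs, cos_atan, sin_atan.
f_equal; field; lra.
Qed.

Lemma Clog_1 : Clog 1 = 0.
Proof.
unfold Clog, Re, Im; simpl fst; simpl snd.
replace (1 ^ 2 + 0 ^ 2)%R with 1%R by ring; replace (0 / 1)%R with 0%R by field.
rewrite ln_1, atan_0; unfold Rdiv; rewrite Rmult_0_l; reflexivity.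
Qed.

(** Obtained from the real [ln] and [atan]; the inverse function argument for the derivative needs
    this continuity beforehand. *)
Lemma Clog_continuous (z : C) : (0 < Re z)%R ->
  forall eps : posreal, locally (T := C_UniformSpace) z
    (fun w => Cmod (Clog w - Clog z) < eps)%R.
Proof.
intros Hz eps.
assert (He : (0 < eps / 4)%R) by (pose proof (cond_pos eps); lra).
assert (HRe : continuous (T := C_UniformSpace) (U := R_UniformSpace) Re z)
  by apply (continuous_fst (U := R_UniformSpace) (V := R_UniformSpace)).
assert (HIm : continuous (T := C_UniformSpace) (U := R_UniformSpace) Im z)
  by apply (continuous_snd (U := R_UniformSpace) (V := R_UniformSpace)).
assert (Hln : continuous (T := C_UniformSpace) (U := R_UniformSpace)
  (fun w => Re (Clog w)) z).
{ apply (continuous_comp (fun w : C_UniformSpace => Re w ^ 2 + Im w ^ 2)%R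
    (fun x => ln x / 2)%R).
  - apply (continuous_plus (K := R_AbsRing) (V := R_NormedModule)).
    + apply (continuous_comp Re (fun x => x ^ 2)%R); auto.
      apply (ex_derive_continuous (K := R_AbsRing) (V := R_NormedModule)); auto_derive; auto.
    + apply (continuous_comp Im (fun x => x ^ 2)%R); auto.
      apply (ex_derive_continuous (K := R_AbsRing) (V := R_NormedModule)); auto_derive; auto.
  - apply (ex_derive_continuous (K := R_AbsRing) (V := R_NormedModule)); auto_derive; nra. }
assert (Hatan : continuous (T := C_UniformSpace) (U := R_UniformSpace)
  (fun w => Im (Clog w)) z).
{ apply (continuous_comp (fun w : C_UniformSpace => Im w * / Re w)%R atan).
  - apply (continuous_mult (K := R_AbsRing)); auto.
    apply (continuous_comp Re Rinv); auto.
    apply (ex_derive_continuous (K := R_AbsRing) (V := R_NormedModule)); auto_derive; lra.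
  - apply continuous_atan. }
assert (L1 := proj1 (filterlim_locally _ _) Hln (mkposreal _ He)).
assert (L2 := proj1 (filterlim_locally _ _) Hatan (mkposreal _ He)).
generalize (filter_and _ _ L1 L2); apply filter_imp; intros w [B1 B2].
apply Rle_lt_trans with (2 * (eps / 4))%R; [|lra].
apply Cmod_le_Re_Im; left; [exact B1 | exact B2].
Qed.

(** For the increment [u] of the logarithm, [Cexp u = w / z], so the relative increment [e] of the
    argument satisfies [e - u = Cexp_rem 2 u], which is quadratic in [u]. For small [u] this forces
    [Cmod u <= 2 * Cmod e], and the error is then negligible against [e]. *)
Lemma is_C_derive_Clog (z : C) : (0 < Re z)%R -> is_C_derive Clog z (/ z).
Proof.
intros Hz; apply is_C_derive_eps; intros eps.
assert (Hz0 : z <> 0) by (intros E; rewrite E in Hz; simpl in Hz; lra).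
assert (Hm : (0 < Cmod z)%R) by now apply Cmod_gt_0.
set (r := (eps * Cmod z / 24)%R).
assert (Hr : (0 < r)%R).
{ pose proof (cond_pos eps); unfold r; nra. }
assert (L := Clog_continuous z Hz (mkposreal (Rmin (1 / 24) r) ltac:(apply Rmin_pos; lra))).
assert (Lp : locally (T := C_UniformSpace) z (fun w => 0 < Re w)%R).
{ apply locally_C_Cmod; exists (mkposreal _ Hz); simpl; intros w Hw.
  pose proof (re_le_Cmod (w - z)) as T; unfold Cminus in T at 1.
  rewrite re_plus, re_opp in T; pose proof (Rabs_def2 _ _ (Rle_lt_trans _ _ _ T Hw)); lra. }
assert (L' := filter_and _ _ L Lp).
apply locally_C_Cmod in L'; destruct L' as [d Hd].
exists d; intros w Hw; destruct (Hd w Hw) as [B Hwp]; simpl in B.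
assert (H1 := Rlt_le_trans _ _ _ B (Rmin_l (1 / 24) r)).
assert (H2 := Rlt_le_trans _ _ _ B (Rmin_r (1 / 24) r)).
set (u := Clog w - Clog z) in *.
set (e := (w - z) * / z).
assert (E : e - u = Cexp_rem 2 u).
{ assert (Hu : Cexp u * z = w).
  { rewrite <- (Cexp_Clog z Hz) at 1; rewrite <- Cexp_plus.
    replace (u + Clog z) with (Clog w) by (unfold u; ring); now apply Cexp_Clog. }
  unfold e; rewrite <- Hu; simpl; field; auto using C1_nz. }
pose proof (Cexp_rem_bound 2 u ltac:(lra)) as B2; rewrite <- E in B2.
pose proof (Cmod_ge_0 u) as Hu.
assert (He : (Cmod u <= 2 * Cmod e)%R).
{ pose proof (Cmod_triangle e (- (e - u))) as T; rewrite Cmod_opp in T.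
  replace (e + - (e - u)) with u in T by ring; simpl in B2; nra. }
assert (Em : (Cmod e * Cmod z = Cmod (w - z))%R).
{ rewrite <- Cmod_mult; f_equal; unfold e; field; auto. }
replace (u - e) with (- (e - u)) by ring; rewrite Cmod_opp, <- Em.
apply Rle_trans with (1 := B2); simpl.
apply Rle_trans with (12 * (Cmod u * r))%R; [nra|].
replace (eps * (Cmod e * Cmod z))%R with (12 * (2 * Cmod e * r))%R by (unfold r; field).
nra.
Qed.

(** * Existence of the phase *)

(** The value and first derivative at 0 travel together because the chain rule needs the former, and
    because the phase is normalized by value 0 and derivative 1. *)
Definition holomorphic_germ (f : C -> C) (v l : C) : Prop :=
  f 0 = v /\ is_C_derive f 0 l /\
  locally (T := C_UniformSpace) (RtoC 0) (fun z => exists m, is_C_derive f z m).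

Lemma germ_const (c : C) : holomorphic_germ (fun _ => c) c 0.
Proof.
split; [reflexivity|]; split; [apply is_C_derive_const|].
apply filter_forall; intros z; exists 0; apply is_C_derive_const.
Qed.

Lemma germ_id : holomorphic_germ (fun z => z) 0 1.
Proof.
split; [reflexivity|]; split; [apply is_C_derive_id|].
apply filter_forall; intros z; exists 1; apply is_C_derive_id.
Qed.

Lemma germ_plus (f g : C -> C) (v w l m : C) :
  holomorphic_germ f v l -> holomorphic_germ g w m ->
  holomorphic_germ (fun z => f z + g z) (v + w) (l + m).
Proof.
intros [Hf [Df Lf]] [Hg [Dg Lg]]; split; [now rewrite Hf, Hg|].
split; [now apply is_C_derive_plus|].
generalize (filter_and _ _ Lf Lg); apply filter_imp; intros z [[a Ha] [b Hb]].
exists (a + b); now apply is_C_derive_plus.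
Qed.

Lemma germ_mult (f g : C -> C) (v w l m : C) :
  holomorphic_germ f v l -> holomorphic_germ g w m ->
  holomorphic_germ (fun z => f z * g z) (v * w) (l * w + v * m).
Proof.
intros [Hf [Df Lf]] [Hg [Dg Lg]]; split; [now rewrite Hf, Hg|].
split; [rewrite <- Hf, <- Hg; now apply is_C_derive_mult|].
generalize (filter_and _ _ Lf Lg); apply filter_imp; intros z [[a Ha] [b Hb]].
exists (a * g z + f z * b); now apply is_C_derive_mult.
Qed.

Lemma germ_Cexp (f : C -> C) (v l : C) : holomorphic_germ f v l ->
  holomorphic_germ (fun z => Cexp (f z)) (Cexp v) (l * Cexp v).
Proof.
intros [Hf [Df Lf]]; split; [now rewrite Hf|].
split; [rewrite <- Hf; apply is_C_derive_comp; auto using is_C_derive_Cexp|].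
revert Lf; apply filter_imp; intros z [a Ha].
exists (a * Cexp (f z)); apply is_C_derive_comp; auto using is_C_derive_Cexp.
Qed.

Lemma germ_Re_pos (f : C -> C) (l : C) : holomorphic_germ f 1 l ->
  locally (T := C_UniformSpace) (RtoC 0) (fun z => 0 < Re (f z))%R.
Proof.
intros [Hf [Df _]]; apply locally_C_Cmod.
destruct (proj1 (is_C_derive_eps _ _ _) Df (mkposreal 1 Rlt_0_1)) as [d Hd].
pose proof (Cmod_ge_0 l) as Hl.
(* Differentiability with tolerance 1 bounds [Cmod (f z - 1)] by [(Cmod l + 1) * Cmod z], at most
   [1 / 2] on this disc. *)
set (r := (/ (2 * (Cmod l + 1)))%R).
assert (Hr : (0 < r)%R) by (apply Rinv_0_lt_compat; lra).
assert (Er : (r * (2 * (Cmod l + 1)) = 1)%R) by (apply Rinv_l; lra).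
exists (mkposreal (Rmin d r) (Rmin_pos _ _ (cond_pos d) Hr)); simpl; intros z Hz.
specialize (Hd z (Rlt_le_trans _ _ _ Hz (Rmin_l _ _))).
assert (Hz2 := Rlt_le_trans _ _ _ Hz (Rmin_r _ _)).
replace (z - 0) with z in Hd, Hz2 by ring; rewrite Hf in Hd; simpl in Hd.
pose proof (Cmod_triangle (f z - 1 - z * l) (z * l)) as T.
replace (f z - 1 - z * l + z * l) with (f z - 1) in T by ring.
rewrite Cmod_mult in T.
pose proof (re_le_Cmod (f z - 1)) as T'; unfold Cminus in T' at 1.
rewrite re_plus, re_opp in T'; simpl Re in T'.
assert (Hm : (Cmod z * (Cmod l + 1) <= r * (Cmod l + 1))%R).
{ apply Rmult_le_compat_r; lra. }
assert (B : (Rabs (Re (f z) + - (1)) < 1)%R) by lra.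
apply Rabs_def2 in B; lra.
Qed.

Lemma germ_Clog (f : C -> C) (l : C) : holomorphic_germ f 1 l ->
  holomorphic_germ (fun z => Clog (f z)) 0 l.
Proof.
intros Hg; pose proof (germ_Re_pos f l Hg) as Hp; destruct Hg as [Hf [Df Lf]].
split; [now rewrite Hf, Clog_1|].
split.
- replace l with (l * / 1) by (field; apply C1_nz).
  apply is_C_derive_comp; auto.
  rewrite Hf; apply is_C_derive_Clog; simpl; lra.
- generalize (filter_and _ _ Hp Lf); apply filter_imp; intros z [Hz [a Ha]].
  exists (a * / f z); apply is_C_derive_comp; auto using is_C_derive_Clog.
Qed.

Definition Csqrt (z : C) : C := Cexp (/ 2 * Clog z).

Lemma Csqrt_sqr (z : C) : (0 < Re z)%R -> Csqrt z * Csqrt z = z.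
Proof.
intros Hz; unfold Csqrt; rewrite <- Cexp_plus.
rewrite <- (Cexp_Clog z Hz) at 3; f_equal; field; apply RtoC_neq_0; lra.
Qed.

Lemma germ_ext (f : C -> C) (v w l m : C) : holomorphic_germ f v l ->
  v = w -> l = m -> holomorphic_germ f w m.
Proof. now intros H <- <-. Qed.

Lemma germ_Csqrt (f : C -> C) : holomorphic_germ f 1 0 ->
  holomorphic_germ (fun z => Csqrt (f z)) 1 0.
Proof.
intros Hf; eapply germ_ext.
- apply germ_Cexp, germ_mult; [apply germ_const | apply germ_Clog, Hf].
- rewrite Cmult_0_r; apply Cexp_0.
- ring.
Qed.

Lemma germ_numerical_phase (a : C) (theta : C -> C) : holomorphic_germ theta 0 1 ->
  locally (T := C_UniformSpace) (RtoC 0) (fun q => Ccos (theta q) = A a q) ->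
  is_numerical_phase a theta.
Proof.
intros [H0 [D L]] Hcos; split; [|split; [exact Hcos|]].
- revert L; apply filter_imp; intros q [m Hm]; exists m; now apply is_C_derive_correct.
- intros eps.
  destruct (proj1 (is_C_derive_eps _ _ _) D eps) as [d Hd].
  apply locally_C_Cmod; exists d; intros q Hq _.
  specialize (Hd q Hq); rewrite H0 in Hd.
  change (Cmod (q - theta q) <= eps * Cmod q)%R.
  rewrite <- Cmod_opp.
  replace (- (q - theta q)) with (theta q - 0 - (q - 0) * 1) by ring.
  now replace (q - 0) with q in Hd at 2 by ring.
Qed.

(* [cos theta = A] amounts to [sin (theta / 2) = w], [w = q / 2 sqrt (1 - g2 q^2)],
   which is solved by [exp (i theta / 2) = i w + sqrt (1 - w^2)]. *)
Lemma numerical_phase_exists (a : C) : exists theta, is_numerical_phase a theta.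
Proof.
assert (H2 : RtoC 2 <> 0) by (apply RtoC_neq_0; lra).
set (f := fun q : C => 1 + - g2 a * (q * q)).
set (w := fun q : C => / 2 * (q * Csqrt (f q))).
set (h := fun q : C => 1 + - (1) * (w q * w q)).
set (zeta := fun q : C => Ci * w q + Csqrt (h q)).
assert (Gf : holomorphic_germ f 1 0).
{ eapply germ_ext.
  - apply germ_plus; [apply germ_const|]; apply germ_mult; [apply germ_const|].
    apply germ_mult; apply germ_id.
  - ring.
  - ring. }
assert (Gw : holomorphic_germ w 0 (/ 2)).
{ eapply germ_ext.
  - apply germ_mult; [apply germ_const|]; apply germ_mult; [apply germ_id|].
    apply germ_Csqrt, Gf.
  - ring.
  - ring. }
assert (Gh : holomorphic_germ h 1 0).
{ eapply germ_ext.
  - apply germ_plus; [apply germ_const|]; apply germ_mult; [apply germ_const|].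
    apply germ_mult; apply Gw.
  - ring.
  - ring. }
assert (Gz : holomorphic_germ zeta 1 (Ci * / 2)).
{ eapply germ_ext.
  - apply germ_plus; [apply germ_mult; [apply germ_const | apply Gw]|].
    apply germ_Csqrt, Gh.
  - ring.
  - ring. }
exists (fun q => - (2) * Ci * Clog (zeta q)).
apply germ_numerical_phase.
- eapply germ_ext.
  + apply germ_mult; [apply germ_const | apply germ_Clog, Gz].
  + ring.
  + transitivity (- (Ci * Ci)); [field; auto | rewrite Ci_Ci; ring].
- generalize (filter_and _ _ (germ_Re_pos _ _ Gf)
    (filter_and _ _ (germ_Re_pos _ _ Gh) (germ_Re_pos _ _ Gz))).
  apply filter_imp; intros q [Pf [Ph Pz]].
  assert (Ei : Ci * (- (2) * Ci * Clog (zeta q)) = Clog (zeta q) + Clog (zeta q)).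
  { transitivity (- (2) * (Ci * Ci) * Clog (zeta q)); [ring | rewrite Ci_Ci; ring]. }
  unfold Ccos; rewrite Ei.
  set (s := Csqrt (h q)).
  assert (Es : s * s = 1 - w q * w q).
  { unfold s; rewrite Csqrt_sqr by exact Ph; unfold h; ring. }
  assert (Ew : w q * w q = q ^ 2 / 4 * (1 - g2 a * q ^ 2)).
  { transitivity (q ^ 2 / 4 * (Csqrt (f q) * Csqrt (f q))).
    - unfold w; field; repeat split; auto; apply RtoC_neq_0; lra.
    - rewrite Csqrt_sqr by exact Pf; unfold f; ring. }
  assert (E1 : Cexp (Clog (zeta q)) = Ci * w q + s) by now apply Cexp_Clog.
  assert (E2 : Cexp (- Clog (zeta q)) = s - Ci * w q).
  (* The inverse of [Ci * w q + s] is [s - Ci * w q], because their product is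
     [s * s + w q * w q = 1]. *)
  { transitivity (Cexp (Clog (zeta q)) * Cexp (- Clog (zeta q)) * (s - Ci * w q)).
    - transitivity (Cexp (- Clog (zeta q)) * (s * s - (Ci * Ci) * (w q * w q))).
      + rewrite Es, Ci_Ci; ring.
      + rewrite E1; ring.
    - rewrite Cexp_opp_r; ring. }
  replace (- (Clog (zeta q) + Clog (zeta q)))
    with (- Clog (zeta q) + - Clog (zeta q)) by ring.
  rewrite !Cexp_plus, E1, E2.
  transitivity (s * s + (Ci * Ci) * (w q * w q)); [field; auto|].
  rewrite Es, Ci_Ci.
  transitivity (1 - 2 * (w q * w q)); [ring|].
  rewrite Ew; unfold A; field; repeat split; auto; apply RtoC_neq_0; lra.
Qed.

(** * The cancellation condition *)

Lemma sqrt3_sqr : RtoC (sqrt 3) * RtoC (sqrt 3) = 3.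
Proof. rewrite <- RtoC_mult, sqrt_sqrt; [reflexivity | lra]. Qed.

Lemma sqrt3_neq_0 : RtoC (sqrt 3) <> 0.
Proof.
apply RtoC_neq_0; pose proof (sqrt_lt_R0 3 ltac:(lra)); lra.
Qed.

(** Completing the square gives [- ((a - 1 / 4) ^ 2 + 1 / 48)], and [- 1 / 48] is the square of
    [Ci / (4 * sqrt 3)]. *)
Lemma cancellation_factorization (a : C) :
  g2 a - 1 / 12 = - (a - a_plus) * (a - a_minus).
Proof.
pose proof sqrt3_neq_0 as Hs.
transitivity (- ((a - 1 / 4) * (a - 1 / 4)
  - (Ci * Ci) / (16 * (RtoC (sqrt 3) * RtoC (sqrt 3))))).
- rewrite Ci_Ci, sqrt3_sqr; unfold g2; field; repeat split; apply RtoC_neq_0; lra.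
- unfold a_plus, a_minus; field; auto.
Qed.

Lemma cancellation_solutions (a : C) :
  g2 a = 1 / 12 <-> a = a_plus \/ a = a_minus.
Proof.
rewrite Ceq_minus, cancellation_factorization; split.
- intros H.
  destruct (Ceq_dec a a_plus) as [E|N]; [now left|].
  destruct (Ceq_dec a a_minus) as [E|N']; [now right|].
  exfalso; apply (Cmult_neq_0 (- (a - a_plus)) (a - a_minus)); auto.
  + intros E; apply (Cminus_eq_contra _ _ N).
    rewrite <- (Copp_0), <- E; ring.
  + now apply Cminus_eq_contra.
- intros [-> | ->]; ring.
Qed.

Lemma a_plus_neq_a_minus : a_plus <> a_minus.
Proof.
intros E; apply Ceq_minus in E.
apply Ci_nz; transitivity ((a_plus - a_minus) * (2 * RtoC (sqrt 3))).
- unfold a_plus, a_minus; field; apply sqrt3_neq_0.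
- rewrite E; ring.
Qed.

Lemma a_minus_conj : a_minus = Cconj a_plus.
Proof.
unfold a_plus, a_minus.
replace (4 * RtoC (sqrt 3)) with (RtoC (4 * sqrt 3)) by apply RtoC_mult.
replace (1 / 4) with (RtoC (1 / 4)) by (apply RtoC_div; lra).
assert (H : (4 * sqrt 3 <> 0)%R) by (pose proof (sqrt_lt_R0 3 ltac:(lra)); lra).
unfold Cdiv; rewrite <- RtoC_inv by exact H.
apply injective_projections; simpl; ring.
Qed.

Lemma no_real_cancellation : ~ exists a : R, leading_phase_defect (RtoC a) = RtoC 0.
Proof.
intros [a H].
assert (E : leading_phase_defect (RtoC a) = RtoC ((a - 1 / 4) ^ 2 / 2 + 1 / 96)).
{ unfold leading_phase_defect, g2.
  rewrite RtoC_plus, !RtoC_div, RtoC_pow, RtoC_minus, RtoC_div by lra.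
  field; repeat split; apply RtoC_neq_0; lra. }
rewrite E in H; apply RtoC_inj in H.
pose proof (pow2_ge_0 (a - 1 / 4)); lra.
Qed.

Theorem theorem3p3 :
  (* the numerical phase exists, and leading_phase_defect is its q^3 coefficient *)
  (forall a : C, exists theta : C -> C, is_numerical_phase a theta) /\
  (forall (a : C) (theta : C -> C), is_numerical_phase a theta ->
     is_bigO (locally' (RtoC 0))
       (fun q : C => theta q - (q + leading_phase_defect a * q ^ 3))
       (fun q : C => q ^ 5)) /\
  (* no real coefficient cancels it *)
  (~ exists a : R, leading_phase_defect (RtoC a) = RtoC 0) /\
  (* the complex solutions of the cancellation condition *)
  (forall a : C, g2 a = 1 / 12 <-> a = a_plus \/ a = a_minus) /\
  a_plus <> a_minus /\
  a_minus = Cconj a_plus /\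
  1 - 2 * a_plus = 1 / 2 - Ci / (2 * sqrt 3) /\
  1 - 2 * a_minus = 1 / 2 + Ci / (2 * sqrt 3) /\
  (* the expansion of the phase and of the temporal frequency error *)
  (forall (a : C) (theta : C -> C),
     a = a_plus \/ a = a_minus ->
     is_numerical_phase a theta ->
     is_bigO (locally' (RtoC 0))
       (fun q : C => theta q - (q - q ^ 5 / 720))
       (fun q : C => q ^ 7) /\
     (forall nu Kh : R, (0 < nu)%R -> (0 < Kh)%R ->
        is_bigO (locally' (0%R : R))
          (fun dt : R =>
             theta (RtoC (nu * dt * Kh)%R) / RtoC dt - RtoC (nu * Kh)%R
             - - (RtoC (nu * Kh)%R ^ 5 / 720) * RtoC dt ^ 4)
          (fun dt : R => RtoC dt ^ 6))).
Proof.
repeat apply conj.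
- exact numerical_phase_exists.
- exact phase_expansion3.
- exact no_real_cancellation.
- exact cancellation_solutions.
- exact a_plus_neq_a_minus.
- exact a_minus_conj.
- unfold a_plus; field; repeat split; first [apply sqrt3_neq_0 | apply RtoC_neq_0; lra].
- unfold a_minus; field; repeat split; first [apply sqrt3_neq_0 | apply RtoC_neq_0; lra].
- intros a theta Ha Hth; apply cancellation_solutions in Ha.
  pose proof (phase_expansion5 a theta Hth Ha) as H.
  split; [exact H|].
  intros nu Kh Hnu HK; now apply frequency_error.
Qed.
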